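(* Let $n\ge 1$, let $A=(a_{ij})\in\mathbb{R}^{n\times n}$ and let $\tilde b_1,\dots,\tilde b_n\in\mathcal{X}$. Assume $\det A\neq 0$. Then the system of $n$ fuzzy linear equations in the unknowns $\tilde x_1,\dots,\tilde x_n\in\mathcal{X}$ $$a_{i1}\tilde x_1+a_{i2}\tilde x_2+\cdots+a_{in}\tilde x_n=\tilde b_i,\qquad i=1,\dots,n,$$ has a unique solution, which is given by $$\tilde x_j=(\det A)^{-1}\left(\sum_{i=1}^n(-1)^{i+j}\det(A_{ij})\,\tilde b_i\right),\qquad j=1,\dots,n,$$ where $A_{ij}$ is the $(n-1)\times(n-1)$ matrix obtained from $A$ by deleting row $i$ and column $j$ (for $n=1$, $\det(A_{11})=1$).
   Context: Gaussian-PDMF space $\mathcal{X}$: the set of functions $f:\mathbb{R}\to[0,1]$ with parameters $x\in\mathbb{R}$, $d^-,d^+>0$, $\mu^-,\mu^+\in\mathbb{R}$, given by $f(x)=1$, $f(\tau)=0$ for $\tau\le x-d^-$ or $\tau\ge x+d^+$, $f(\tau)=\int_{-\infty}^{\tan(\frac{\pi}{d^-}(\tau-x+d^-)-\frac{\pi}{2})}\frac{1}{\sqrt{2\pi}}e^{-\frac12(t-\mu^-)^2}dt$ for $\tau\in(x-d^-,x)$, and $f(\tau)=\int_{-\infty}^{\tan(\frac{\pi}{d^+}(x+d^+-\tau)-\frac{\pi}{2})}\frac{1}{\sqrt{2\pi}}e^{-\frac12(t-\mu^+)^2}dt$ for $\tau\in(x,x+d^+)$. Such an element is identified with its parameter tuple,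 written $\tilde x=\langle x;d^-,d^+,\mu^-,\mu^+\rangle$; two elements are equal iff all five parameters coincide. Operations on $\mathcal{X}$, for $\tilde x_i=\langle x_i;d_i^-,d_i^+,\mu_i^-,\mu_i^+\rangle$ and $\lambda\in\mathbb{R}$: $\tilde x_1+\tilde x_2=\langle x_1+x_2;d_1^-d_2^-,d_1^+d_2^+,\mu_1^-+\mu_2^-,\mu_1^++\mu_2^+\rangle$; $\lambda\tilde x=\langle\lambda x;(d^-)^\lambda,(d^+)^\lambda,\lambda\mu^-,\lambda\mu^+\rangle$. With these operations $\mathcal{X}$ is a real vector space with zero element $\tilde 0=\langle 0;1,1,0,0\rangle$. *)

(* Defs.v *)
From HB Require Import structures.
From mathcomp Require Export all_boot all_order all_algebra.
From mathcomp Require Export all_classical all_reals all_analysis.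
From mathcomp Require Import ring lra.

Set Implicit Arguments.
Unset Strict Implicit.
Unset Printing Implicit Defensive.

Import Order.TTheory GRing.Theory Num.Theory.
Import numFieldNormedType.Exports.
Local Open Scope classical_set_scope.
Local Open Scope ring_scope.

(* The parameter tuple < x; d-, d+, mu-, mu+ > of a Gaussian-PDMF.  A PDMF is
   identified with its tuple: [pdmf_fun] below is the membership function, and
   [pdmf_fun_inj] proves that it determines all five parameters. *)
Record gpdmf (R : realType) := GPDMF {
  core : R;
  dminus : R;
  dplus : R;
  muminus : R;
  muplus : R;
  dminus_gt0 : 0 < dminus;
  dplus_gt0 : 0 < dplus }.

Definition gauss_cdf (R : realType) (m y : R) : R :=
  \int[lebesgue_measure]_(t in `]-oo, y])
    ((Num.sqrt (2 * pi))^-1 * expR (- (2^-1 * (t - m) ^+ 2))).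

Definition pdmf_fun (R : realType) (p : gpdmf R) (t : R) : R :=
  if t == core p then 1
  else if (t <= core p - dminus p) || (core p + dplus p <= t) then 0
  else if t < core p then
    gauss_cdf (muminus p)
      (tan (pi / dminus p * (t - core p + dminus p) - pi / 2))
  else
    gauss_cdf (muplus p)
      (tan (pi / dplus p * (core p + dplus p - t) - pi / 2)).

Section Gauss_cdf.
Variable R : realType.
Notation mu := (@lebesgue_measure R).

Lemma normal_pdf1E (m t : R) : normal_pdf m 1 t =
   (Num.sqrt (2 * pi))^-1 * expR (- (2^-1 * (t - m) ^+ 2)).
Proof.
rewrite normal_pdfE ?oner_neq0 // /normal_peak /normal_fun !expr1n mul1r mulr_natl.
by congr (_ * expR _); rewrite mulNr mulrC.
Qed.

Lemma gauss_cdfE (m y : R) : (gauss_cdf m y)%:E = normal_prob m 1 `]-oo, y].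
Proof.
rewrite /gauss_cdf /Rintegral.
under eq_integral do rewrite -normal_pdf1E.
rewrite fineK //; exact: (@fin_num_measure _ _ _ (normal_prob m 1)).
Qed.

Lemma lt_Rint (D : set R) (f g : R -> R) : measurable D -> mu D != 0%E ->
  mu.-integrable D (EFin \o f) -> mu.-integrable D (EFin \o g) ->
  {in D, forall t, f t < g t} ->
  \int[mu]_(t in D) f t < \int[mu]_(t in D) g t.
Proof.
move=> mD D0 intf intg fg; rewrite lt_neqAle; apply/andP; split; last first.
  by apply: le_Rintegral => // t Dt; rewrite ltW // fg // inE.
apply: contra D0 => /eqP fg0.
have intgf : mu.-integrable D (fun t => (g t - f t)%:E).
  rewrite (_ : (fun _ => _) = (EFin \o g) \- (EFin \o f))%E; last first.
    by apply/funext => t; rewrite /= EFinB.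
  exact: integrableB.
have i0 : (\int[mu]_(t in D) `|(g t - f t)%:E| = 0)%E.
  transitivity (\int[mu]_(t in D) (g t - f t)%:E)%E.
    apply: eq_integral => t /fg h; by rewrite abse_EFin gtr0_norm ?subr_gt0.
  have h0 := @RintegralB _ _ _ mu D g f mD intg intf.
  rewrite fg0 subrr in h0.
  have fi : (\int[mu]_(t in D) (g t - f t)%:E)%E \is a fin_num.
    exact: integrable_fin_num.
  by rewrite -(fineK fi); congr (_%:E).
move/(ae_eq_integral_abs mu mD (measurable_int mu intgf)): i0 => [N [mN N0 sN]].
rewrite -measure_le0; apply: (@le_trans _ _ (mu N)); last by rewrite N0.
apply: le_measure; rewrite ?inE //; move=> t Dt; apply: sN => /(_ Dt) /=.
move=> [] /eqP; rewrite subr_eq0 => /eqP h.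
by have := fg t; rewrite inE => /(_ Dt); rewrite h ltxx.
Qed.

Lemma mu_ray (y : R) : mu `]-oo, y] != 0%E.
Proof. by rewrite lebesgue_measure_itv /= ltNyr. Qed.

Lemma int_ray (m y : R) : mu.-integrable `]-oo, y] (EFin \o normal_pdf m 1).
Proof. exact: (integrableS _ _ _ (integrable_normal_pdf m 1)). Qed.

Lemma gauss_cdf_ge0 (m y : R) : 0 <= gauss_cdf m y.
Proof. by rewrite -lee_fin gauss_cdfE; exact: measure_ge0. Qed.

Lemma gauss_cdf_gt0 (m y : R) : 0 < gauss_cdf m y.
Proof.
rewrite /gauss_cdf; under eq_Rintegral do rewrite -normal_pdf1E.
have <- : \int[mu]_(t in `]-oo, y]) (fun=> 0) t = 0.
  by rewrite /Rintegral integral0.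
apply: lt_Rint => //; [exact: mu_ray|exact: integrable0|exact: int_ray|].
by move=> t _; rewrite normal_pdfE ?oner_neq0 // mulr_gt0 ?expR_gt0 // normal_peak_gt0 ?oner_neq0.
Qed.

Lemma gauss_cdf_lt1 (m y : R) : gauss_cdf m y < 1.
Proof.
rewrite -lte_fin gauss_cdfE.
have e : 1%E = (normal_prob m 1 `]-oo, y] + normal_prob m 1 `]y, +oo[)%E.
  rewrite -[LHS](probability_setT (normal_prob m 1)).
  rewrite -(@measureU _ _ _ (normal_prob m 1)) //.
    congr (normal_prob m 1 _); apply/seteqP; split=> t //= _.
    by case: (leP t y) => h; [left|right]; rewrite /= in_itv /= ?h.
  by apply/seteqP; split=> // t /= []; rewrite !in_itv /= andbT => h /lt_le_trans /(_ h); rewrite ltxx.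
rewrite e lteDl; last exact: (@fin_num_measure _ _ _ (normal_prob m 1)).
have <- : (\int[mu]_(t in `]y, +oo[) (fun=> 0) t)%:E = 0%E :> \bar R.
  by rewrite /Rintegral integral0.
have -> : normal_prob m 1 `]y, +oo[ = (\int[mu]_(t in `]y, +oo[) normal_pdf m 1 t)%:E.
  by rewrite /Rintegral fineK //; exact: (@fin_num_measure _ _ _ (normal_prob m 1)).
rewrite lte_fin; apply: lt_Rint => //; [|exact: integrable0| |].
- by rewrite lebesgue_measure_itv /= ltry.
- exact: (integrableS _ _ _ (integrable_normal_pdf m 1)).
by move=> t _; rewrite normal_pdfE ?oner_neq0 // mulr_gt0 ?expR_gt0 // normal_peak_gt0 ?oner_neq0.
Qed.

Lemma gauss_cdf_mean_lt (m n : R) : m < n ->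
  gauss_cdf n ((m + n) / 2) < gauss_cdf m ((m + n) / 2).
Proof.
move=> mn; rewrite /gauss_cdf.
under eq_Rintegral do rewrite -normal_pdf1E.
under [ltRHS]eq_Rintegral do rewrite -normal_pdf1E.
rewrite -!Rintegral_itv_bndo_bndc;
  try exact: (integrableS _ _ _ (integrable_normal_pdf _ 1)).
apply: lt_Rint => //.
- by rewrite lebesgue_measure_itv /= ltNyr.
- exact: (integrableS _ _ _ (integrable_normal_pdf _ 1)).
- exact: (integrableS _ _ _ (integrable_normal_pdf _ 1)).
move=> t; rewrite inE /= in_itv /= => tm.
rewrite !normal_pdf1E ltr_pM2l; last by rewrite invr_gt0 sqrtr_gt0 mulr_gt0 ?pi_gt0.
rewrite ltr_expR; nra.
Qed.

Lemma gauss_cdf_inj (m n : R) : gauss_cdf m =1 gauss_cdf n -> m = n.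
Proof.
by move=> e; case: (ltgtP m n) => // /gauss_cdf_mean_lt; rewrite e ltxx.
Qed.
End Gauss_cdf.

Section Membership.
Variable R : realType.
Implicit Types p q : gpdmf R.

Lemma gpdmf_ext p q : core p = core q -> dminus p = dminus q ->
  dplus p = dplus q -> muminus p = muminus q -> muplus p = muplus q -> p = q.
Proof.
case: p q => x a b m n ha hb [x' a' b' m' n' ha' hb'] /= ? ? ? ? ?; subst.
by rewrite (bool_irrelevance ha ha') (bool_irrelevance hb hb').
Qed.

Lemma pdmf_fun_ge0 p t : 0 <= pdmf_fun p t.
Proof. by rewrite /pdmf_fun; do 3?[case: ifP => // _]; rewrite ?gauss_cdf_ge0. Qed.

Lemma pdmf_fun_le1 p t : pdmf_fun p t <= 1.
Proof.
by rewrite /pdmf_fun; do 3?[case: ifP => // _]; rewrite ?ltW ?gauss_cdf_lt1.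
Qed.

Lemma pdmf_fun_core p : pdmf_fun p (core p) = 1.
Proof. by rewrite /pdmf_fun eqxx. Qed.

Lemma pdmf_fun_eq1 p t : pdmf_fun p t = 1 -> t = core p.
Proof.
rewrite /pdmf_fun; case: eqP => // _; case: ifP => _.
  by move/esym/eqP; rewrite oner_eq0.
by case: ifP => _ /eqP; rewrite lt_eqF ?gauss_cdf_lt1.
Qed.

Lemma pdmf_fun_eq0 p t :
  pdmf_fun p t = 0 <-> t <= core p - dminus p \/ core p + dplus p <= t.
Proof.
have dm0 := dminus_gt0 p; have dp0 := dplus_gt0 p.
rewrite /pdmf_fun; case: eqP => [->|_].
  by split=> [/eqP|]; [rewrite oner_eq0|case; lra].
case: ifP => [/orP //|/negbT]; rewrite negb_or -!ltNge => /andP[h1 h2].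
split; last by case; lra.
by case: ifP => _ /eqP; rewrite gt_eqF ?gauss_cdf_gt0.
Qed.

Lemma pdmf_fun_left p y : pdmf_fun p
    (core p - dminus p + dminus p / pi * (atan y + pi / 2)) =
  gauss_cdf (muminus p) y.
Proof.
have dm0 := dminus_gt0 p; have dp0 := dplus_gt0 p.
have pi0 := pi_gt0 R; have pi_neq0 : pi != 0 :> R by rewrite gt_eqF.
have dm_neq0 : dminus p != 0 by rewrite gt_eqF.
have a0 : 0 < dminus p / pi * (atan y + pi / 2).
  by rewrite mulr_gt0 ?divr_gt0 //; have := atan_gtNpi2 y; lra.
have a1 : dminus p / pi * (atan y + pi / 2) < dminus p.
  rewrite -[ltRHS](divfK pi_neq0) ltr_pM2l ?divr_gt0 //.
  by have := atan_ltpi2 y; lra.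
rewrite /pdmf_fun; case: eqP => [|_]; first lra.
rewrite ifF; last by apply/negP => /orP[]; lra.
rewrite ifT; last lra.
congr gauss_cdf; rewrite -[RHS](atanK y); congr tan.
by move: (pi) pi_neq0 => P P0; field; rewrite P0 dm_neq0.
Qed.

Lemma pdmf_fun_right p y : pdmf_fun p
    (core p + dplus p - dplus p / pi * (atan y + pi / 2)) =
  gauss_cdf (muplus p) y.
Proof.
have dm0 := dminus_gt0 p; have dp0 := dplus_gt0 p.
have pi0 := pi_gt0 R; have pi_neq0 : pi != 0 :> R by rewrite gt_eqF.
have dp_neq0 : dplus p != 0 by rewrite gt_eqF.
have a0 : 0 < dplus p / pi * (atan y + pi / 2).
  by rewrite mulr_gt0 ?divr_gt0 //; have := atan_gtNpi2 y; lra.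
have a1 : dplus p / pi * (atan y + pi / 2) < dplus p.
  rewrite -[ltRHS](divfK pi_neq0) ltr_pM2l ?divr_gt0 //.
  by have := atan_ltpi2 y; lra.
rewrite /pdmf_fun; case: eqP => [|_]; first lra.
rewrite ifF; last by apply/negP => /orP[]; lra.
rewrite ifF; last by apply/negP; lra.
congr gauss_cdf; rewrite -[RHS](atanK y); congr tan.
by move: (pi) pi_neq0 => P P0; field; rewrite P0 dp_neq0.
Qed.

Lemma pdmf_fun_inj : injective (@pdmf_fun R).
Proof.
move=> p q pq.
have ec : core p = core q.
  by apply: pdmf_fun_eq1; rewrite -pq pdmf_fun_core.
have dm0p := dminus_gt0 p; have dp0p := dplus_gt0 p.
have dm0q := dminus_gt0 q; have dp0q := dplus_gt0 q.
have supp t : (t <= core p - dminus p \/ core p + dplus p <= t) <->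
              (t <= core q - dminus q \/ core q + dplus q <= t).
  by rewrite -!pdmf_fun_eq0 pq.
have em : dminus p = dminus q.
  apply/le_anti/andP; split.
    by have [_ /(_ (or_introl (lexx _)))] := supp (core q - dminus q); case; lra.
  by have [/(_ (or_introl (lexx _))) + _] := supp (core p - dminus p); case; lra.
have ep : dplus p = dplus q.
  apply/le_anti/andP; split.
    by have [_ /(_ (or_intror (lexx _)))] := supp (core q + dplus q); case; lra.
  by have [/(_ (or_intror (lexx _))) + _] := supp (core p + dplus p); case; lra.
apply: gpdmf_ext => //; apply: gauss_cdf_inj => y.
  by rewrite -!pdmf_fun_left pq ec em.
by rewrite -!pdmf_fun_right pq ec ep.
Qed.

End Membership.

Section VectorSpace.
Variable R : realType.
Implicit Types (p q r : gpdmf R) (a b : R).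

Definition gzero : gpdmf R := @GPDMF R 0 1 1 0 0 ltr01 ltr01.

Definition gadd p q : gpdmf R :=
  @GPDMF R (core p + core q) (dminus p * dminus q) (dplus p * dplus q)
    (muminus p + muminus q) (muplus p + muplus q)
    (mulr_gt0 (dminus_gt0 p) (dminus_gt0 q))
    (mulr_gt0 (dplus_gt0 p) (dplus_gt0 q)).

Definition gscale a p : gpdmf R :=
  @GPDMF R (a * core p) (dminus p `^ a) (dplus p `^ a)
    (a * muminus p) (a * muplus p)
    (powR_gt0 a (dminus_gt0 p)) (powR_gt0 a (dplus_gt0 p)).

Definition gopp p : gpdmf R := gscale (-1) p.

HB.instance Definition _ := gen_eqMixin (gpdmf R).
HB.instance Definition _ := gen_choiceMixin (gpdmf R).

Lemma gaddA : associative gadd.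
Proof. by move=> p q r; apply: gpdmf_ext; rewrite /= ?addrA ?mulrA. Qed.

Lemma gaddC : commutative gadd.
Proof. by move=> p q; apply: gpdmf_ext; rewrite /= 1?addrC 1?mulrC. Qed.

Lemma gadd0 : left_id gzero gadd.
Proof. by move=> p; apply: gpdmf_ext; rewrite /= ?add0r ?mul1r. Qed.

Lemma gaddN : left_inverse gzero gopp gadd.
Proof.
move=> p; apply: gpdmf_ext; rewrite /= ?mulN1r ?addNr //.
  by rewrite powR_inv1 ?mulVf ?gt_eqF ?ltW ?dminus_gt0.
by rewrite powR_inv1 ?mulVf ?gt_eqF ?ltW ?dplus_gt0.
Qed.

HB.instance Definition _ :=
  GRing.isZmodule.Build (gpdmf R) gaddA gaddC gadd0 gaddN.

Lemma gscaleA a b p : gscale a (gscale b p) = gscale (a * b) p.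
Proof. by apply: gpdmf_ext; rewrite /= ?mulrA // -powRrM mulrC. Qed.

Lemma gscale1 : left_id 1 gscale.
Proof.
by move=> p; apply: gpdmf_ext; rewrite /= ?mul1r //;
  rewrite powRr1 ?ltW ?dminus_gt0 ?dplus_gt0.
Qed.

Lemma gscaleDr : right_distributive gscale +%R.
Proof.
move=> a p q; apply: gpdmf_ext; rewrite /= ?mulrDr //.
  by rewrite powRM // ltW ?dminus_gt0.
by rewrite powRM // ltW ?dplus_gt0.
Qed.

Lemma gscaleDl p : {morph gscale^~ p : a b / a + b}.
Proof.
move=> a b; apply: gpdmf_ext; rewrite /= ?mulrDl //.
  by rewrite powRD // (gt_eqF (dminus_gt0 p)) implybT.
by rewrite powRD // (gt_eqF (dplus_gt0 p)) implybT.
Qed.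

HB.instance Definition _ :=
  GRing.Zmodule_isLmodule.Build R (gpdmf R) gscaleA gscale1 gscaleDr gscaleDl.

End VectorSpace.

(* Main.v *)
Require Import Defs.

Import Order.TTheory GRing.Theory Num.Theory.
Local Open Scope ring_scope.

(** Only the real vector space structure of the Gaussian-PDMFs matters.  An
    [m x n] matrix over a ring [R] sends a family of [n] vectors of any
    [R]-module to a family of [m] vectors, and composition of these maps is
    the matrix product ([lin_combM]).  The claimed solution is
    [(\det A)^-1 *: (\adj A b)], so Cramer's rule
    [A *m \adj A = \adj A *m A = (\det A)%:M] gives both existence
    and uniqueness as soon as [\det A] is invertible ([lin_comb_cramer]). *)

(** The family [A x] whose [i]-th member is the linear combination of the
    vectors [x j] with coefficients the [i]-th row of [A]. *)
Definition lin_comb {R : pzRingType} {V : lmodType R} {m n : nat}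
    (A : 'M[R]_(m, n)) (x : 'I_n -> V) (i : 'I_m) : V :=
  \sum_(j < n) A i j *: x j.

Lemma lin_combM {R : pzRingType} {V : lmodType R} {m n p : nat}
    (A : 'M[R]_(m, n)) (B : 'M[R]_(n, p)) (x : 'I_p -> V) :
  lin_comb (A *m B) x =1 lin_comb A (lin_comb B x).
Proof.
move=> i; rewrite /lin_comb.
under [RHS]eq_bigr do rewrite scaler_sumr.
rewrite exchange_big /=; apply: eq_bigr => k _.
by rewrite mxE scaler_suml; apply: eq_bigr => j _; rewrite scalerA.
Qed.

Lemma lin_comb_scalar {R : pzRingType} {V : lmodType R} {n : nat} (a : R)
    (x : 'I_n -> V) (i : 'I_n) :
  lin_comb a%:M x i = a *: x i.
Proof.
rewrite /lin_comb (bigD1 i) //= mxE eqxx mulr1n big1 ?addr0 // => j ji.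
by rewrite mxE eq_sym (negbTE ji) mulr0n scale0r.
Qed.

Lemma eq_lin_comb {R : pzRingType} {V : lmodType R} {m n : nat}
    (A : 'M[R]_(m, n)) {x y : 'I_n -> V} :
  x =1 y -> lin_comb A x =1 lin_comb A y.
Proof. by move=> xy i; apply: eq_bigr => j _; rewrite xy. Qed.

Lemma lin_combZ {R : comPzRingType} {V : lmodType R} {m n : nat}
    (A : 'M[R]_(m, n)) (a : R) (x : 'I_n -> V) (i : 'I_m) :
  lin_comb A (fun j => a *: x j) i = a *: lin_comb A x i.
Proof.
rewrite /lin_comb scaler_sumr.
by apply: eq_bigr => j _; rewrite !scalerA mulrC.
Qed.

(** Cramer's rule for linear systems whose unknowns are vectors of a module. *)
Lemma lin_comb_cramer {R : comUnitRingType} {V : lmodType R} {n : nat}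
    {A : 'M[R]_n} (b x : 'I_n -> V) : \det A \is a GRing.unit ->
  lin_comb A x =1 b <-> x =1 (fun j => (\det A)^-1 *: lin_comb (\adj A) b j).
Proof.
move=> uA; split=> [Axb j | xE i].
  rewrite -(eq_lin_comb (\adj A) Axb) -lin_combM mul_adj_mx lin_comb_scalar.
  by rewrite scalerA mulVr // scale1r.
rewrite (eq_lin_comb A xE) lin_combZ -lin_combM mul_mx_adj lin_comb_scalar.
by rewrite scalerA mulVr // scale1r.
Qed.

Theorem theorem3p1 (R : realType) (n : nat) (n_ge1 : (1 <= n)%N)
    (A : 'M[R]_n) (b : 'I_n -> gpdmf R) (detA_neq0 : \det A != 0) :
  let is_solution (x : 'I_n -> gpdmf R) :=
    forall i : 'I_n, \sum_(j < n) A i j *: x j = b i in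
  let x0 (j : 'I_n) : gpdmf R :=
    (\det A)^-1 *:
      \sum_(i < n) ((-1) ^+ (i + j) * \det (row' i (col' j A))) *: b i in
  is_solution x0 /\
  forall x : 'I_n -> gpdmf R, is_solution x -> forall j : 'I_n, x j = x0 j.
Proof.
move=> is_solution x0.
have x0E : x0 =1 (fun j => (\det A)^-1 *: lin_comb (\adj A) b j).
  by move=> j; congr (_ *: _); apply: eq_bigr => i _; rewrite mxE.
have uA : \det A \is a GRing.unit by rewrite unitfE.
split; first exact/(lin_comb_cramer b x0 uA).
by move=> x /(lin_comb_cramer b x uA) xE j; rewrite x0E.
Qed.
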